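(* Let $f(X)=a_{0}+a_{1}X+\cdots +a_{n}X^{n}\in \mathbb{Z}[X]$, $a_{0}a_{n}\neq 0$. Suppose there exist two distinct indices $j_{1},j_{2}\in \{1,\dots ,n-1\}$ such that $j_{1}+j_{2}\neq n$, and two distinct prime numbers $p$ and $q$ such that $\nu _{p}(a_{j_{1}})=\nu _{q}(a_{j_{2}})=0$, $\nu _{p}(a_{0})\nu _{q}(a_{0})\nu _{p}(a_{n})\nu _{q}(a_{n})\neq 0$, and (i) $\frac{\nu _{p}(a_{i})}{j_{1}-i}>\frac{\nu _{p}(a_{0})}{j_{1}}$ for $0<i<j_{1}$, and $\frac{\nu _{p}(a_{i})}{i-j_{1}}>\frac{\nu _{p}(a_{n})}{n-j_{1}}$ for $j_{1}<i<n$; (ii) $\frac{\nu _{q}(a_{i})}{j_{2}-i}>\frac{\nu _{q}(a_{0})}{j_{2}}$ for $0<i<j_{2}$, and $\frac{\nu _{q}(a_{i})}{i-j_{2}}>\frac{\nu _{q}(a_{n})}{n-j_{2}}$ for $j_{2}<i<n$; (iii) $\gcd(\nu _{p}(a_{0}),j_{1})=\gcd(\nu _{p}(a_{n}),n-j_{1})=\gcd(\nu _{q}(a_{0}),j_{2})=\gcd(\nu _{q}(a_{n}),n-j_{2})=1$. Then $f$ is irreducible over $\mathbb{Q}$.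
   Context: For a prime $p$ and a nonzero integer $m$, $\nu_p(m)$ is the largest integer $i$ such that $p^i\mid m$; by convention $\nu_p(0)=\infty$ (so lower bounds on $\nu_p(a_i)$ hold automatically when $a_i=0$). *)

(* Defs.v *)
From HB Require Import structures.
From mathcomp Require Import all_boot all_order all_algebra.
From mathcomp Require Import constructive_ereal.

Set Implicit Arguments.
Unset Strict Implicit.
Unset Printing Implicit Defensive.

Import Order.TTheory GRing.Theory Num.Theory.
Local Open Scope ring_scope.

(* The largest exponent e with p ^ e %| m, as a natural number. It is meant
   for m != 0 only: logn gives the junk value nuN p 0 = 0. *)
Definition nuN (p : nat) (m : int) : nat := logn p `|m|%N.

(* The valuation with the convention nu p 0 = +oo; nu p m / d is +oo when
   m = 0 and d is a positive rational. *)
Definition nu (p : nat) (m : int) : \bar rat :=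
  if m == 0 then +oo%E else ((nuN p m)%:R)%:E.

(* Main.v *)
(* For a prime p, the weight A * nu_p(x_i) + B * i of the terms of a polynomial
   has the Gauss property: its minimum over g * h is at most (in fact equal to)
   the sum of the minima over g and h. Take the two weights constant on the two
   edges of the p-adic Newton polygon of f = g * h, and a term g_u * h_(j - u) of
   the vertex coefficient f_j which is prime to p. The Gauss property forces the
   end points of each edge to split proportionally between g and h; as an edge
   has no interior lattice points, u is 0 or j and deg g - u is 0 or n - j, so
   deg g is one of 0, j, n - j, n. For p and q together only 0 and n remain. *)
Require Import Defs.
From mathcomp Require Import all_boot all_order all_algebra.
From mathcomp Require Import constructive_ereal.
From mathcomp Require Import zify.

Set Implicit Arguments.
Unset Strict Implicit.
Unset Printing Implicit Defensive.

Import Order.TTheory GRing.Theory Num.Theory.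
Local Open Scope ring_scope.

Lemma nuNM (p : nat) (x y : int) : x != 0 -> y != 0 ->
  nuN p (x * y) = (nuN p x + nuN p y)%N.
Proof. by move=> x0 y0; rewrite /nuN abszM lognM ?absz_gt0. Qed.

Lemma dvdz_pexp (p e : nat) (x : int) : prime p -> x != 0 ->
  ((p ^ e)%N %| x)%Z = (e <= nuN p x)%N.
Proof. by move=> pp x0; rewrite dvdzE absz_nat pfactor_dvdn // absz_gt0. Qed.

Lemma nu_eq0 (p : nat) (x : int) : nu p x = 0%E -> x != 0 /\ nuN p x = 0%N.
Proof.
rewrite /nu; case: (eqVneq x 0) => // _ /eqP.
by rewrite eqe pnatr_eq0 => /eqP.
Qed.

(** For nonzero [x] and [y] both valuations are finite, so the inequality in the extended rationals
    compares ordinary fractions and can be cross-multiplied. *)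
Lemma nu_div_lt (p : nat) (x y : int) (c d : nat) : x != 0 -> y != 0 ->
  (0 < c)%N -> (0 < d)%N ->
  (nu p x / (c%:R)%:E < nu p y / (d%:R)%:E)%E ->
  (nuN p x * d < nuN p y * c)%N.
Proof.
rewrite /nu => /negPf -> /negPf -> c0 d0.
rewrite !inver !pnatr_eq0 !eqn0Ngt c0 d0 /= -!EFinM lte_fin.
rewrite ltr_pdivrMr ?ltr0n // mulrAC ltr_pdivlMr ?ltr0n //.
by rewrite -!natrM ltr_nat.
Qed.

Lemma coef_neq0_size (R : nzRingType) (g : {poly R}) (i : nat) :
  g`_i != 0 -> (i < size g)%N.
Proof. by rewrite ltnNge; apply: contraNN => /leq_sizeP ->. Qed.

Section WeightedGauss.

Variables (p A : nat) (B : int).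
Hypotheses (p_prime : prime p) (A_gt0 : (0 < A)%N).

(** A natural [A] and an integer [B] replace a rational slope, so that weights stay in [int]. As
    [nuN] is 0 at 0, a weight is meaningful only at a nonzero coefficient. *)
Definition weight (g : {poly int}) (i : nat) : int :=
  (A * nuN p g`_i)%:Z + B * i%:Z.

(** Ties go to the smallest index; the strict inequality to the left of [i0] is what later singles
    out one term of a product coefficient. *)
Lemma lowest_weight (g : {poly int}) (i : nat) : g`_i != 0 ->
  exists i0, [/\ g`_i0 != 0, weight g i0 <= weight g i
    & forall k, g`_k != 0 ->
        weight g i0 <= weight g k /\
        ((k < i0)%N -> weight g i0 < weight g k)].
Proof.
move=> gi0.
pose P := [pred k : 'I_(size g) | g`_k != 0].
have Pi : P (Ordinal (coef_neq0_size gi0)) by [].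
case: (arg_minP (fun k : 'I_(size g) => weight g k) Pi) => m Pm minm.
have ex : exists k, (g`_k != 0) && (weight g k == weight g m).
  by exists (m : nat); rewrite eqxx andbT; apply: Pm.
case: (ex_minnP ex) => i0 /andP[gi00 /eqP wi0] min_i0.
have le_w k : g`_k != 0 -> weight g m <= weight g k.
  by move=> gk; apply: (minm (Ordinal (coef_neq0_size gk))).
exists i0; split; rewrite ?wi0 //; first exact: le_w.
move=> k gk; split; first exact: le_w.
move=> ki0; rewrite lt_neqAle le_w // andbT.
apply: contraTneq ki0 => wk; rewrite -leqNgt min_i0 //.
by rewrite gk wk eqxx.
Qed.

(* The product of the first coefficients of minimal weight in g and in h is the
   unique term of least valuation in its coefficient of g * h. *)
Lemma weight_mul_le (g h : {poly int}) (i k : nat) :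
  g`_i != 0 -> h`_k != 0 ->
  exists l, (g * h)`_l != 0 /\ weight (g * h) l <= weight g i + weight h k.
Proof.
move=> /lowest_weight[i0 [gi0 lei mini]] /lowest_weight[k0 [hk0 lek mink]].
exists (i0 + k0)%N; set l := (i0 + k0)%N.
pose v := (nuN p g`_i0 + nuN p h`_k0)%N.
(* Stated by divisibility, because the coefficient at [l] is not yet known to be nonzero and some
   terms of its sum may vanish. *)
have ndvd : ~~ ((p ^ v.+1)%N %| (g * h)`_l)%Z.
  have i0l : (i0 < l.+1)%N by rewrite ltnS leq_addr.
  rewrite coefM (bigD1 (Ordinal i0l)) //= /l addKn rpredDr.
    by rewrite dvdz_pexp ?mulf_neq0 // nuNM // ltnn.
  apply: rpred_sum => -[m /= lm]; rewrite -val_eqE /= => mi0.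
  have [->|gm] := eqVneq g`_m 0; first by rewrite mul0r dvdz0.
  have [->|hm] := eqVneq h`_(l - m) 0; first by rewrite mulr0 dvdz0.
  rewrite -/(_ \in dvdz _) dvdz_pexp ?mulf_neq0 // nuNM //.
  have [lew ltw] := mini _ gm; have [lew' ltw'] := mink _ hm.
  (* Either [m < i0], or [m > i0] and then [l - m < k0]: one factor lies strictly before its first
     minimum. *)
  have : weight g i0 + weight h k0 < weight g m + weight h (l - m).
    have [mlt|mgt|emi] := ltngtP m i0; last by rewrite emi eqxx in mi0.
      by apply: ltr_leD => //; apply: ltw.
    by move=> *; apply: ler_ltD => //; lia.
  (* Both index pairs sum to [l], so the linear parts cancel and only valuations remain. *)
  have : B * m%:Z + B * (l - m)%N%:Z = B * i0%:Z + B * k0%:Z.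
    by rewrite -!mulrDr -!PoszD; congr (B * Posz _); lia.
  rewrite /weight /v => eqB ltw2.
  have : (A * (nuN p g`_i0 + nuN p h`_k0) < A * (nuN p g`_m + nuN p h`_(l - m)))%N.
    by rewrite !mulnDr; lia.
  by rewrite ltn_pmul2l.
have l0 : (g * h)`_l != 0 by apply: contraNneq ndvd => ->; rewrite dvdz0.
split=> //; apply: le_trans (lerD lei lek).
move: ndvd; rewrite dvdz_pexp // -leqNgt /v /weight /l; nia.
Qed.

Lemma weight_mul_ge (g h : {poly int}) (C : int) (i k : nat) :
  (forall l, (g * h)`_l != 0 -> C <= weight (g * h) l) ->
  g`_i != 0 -> h`_k != 0 -> C <= weight g i + weight h k.
Proof.
move=> geC gi /(weight_mul_le gi)[l [ghl lel]].
exact: le_trans (geC l ghl) lel.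
Qed.

End WeightedGauss.

(** The two inequalities add up to [(x + y) * j] on either side, so each of them is an equality. *)
Lemma edge_eq (x y u w j : nat) : (u + w = j)%N ->
  ((x + y) * u <= x * j)%N -> ((x + y) * w <= y * j)%N ->
  ((x + y) * u = x * j)%N.
Proof. by move=> <-; rewrite !mulnDl !mulnDr; lia. Qed.

(* The hypotheses say that the p-adic Newton polygon of g * h has the vertex
   (j, 0) and, on each side of it, one edge without interior lattice points. *)
Lemma newton_factor_size (p j n : nat) (g h : {poly int}) : prime p ->
  (0 < j < n)%N -> size (g * h) = n.+1 -> (g * h)`_0 != 0 ->
  (g * h)`_j != 0 -> nuN p (g * h)`_j = 0%N ->
  (forall i, (0 < i < j)%N -> (g * h)`_i != 0 ->
     (nuN p (g * h)`_0 * (j - i) <= nuN p (g * h)`_i * j)%N) ->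
  (forall i, (j < i < n)%N -> (g * h)`_i != 0 ->
     (nuN p (g * h)`_n * (i - j) <= nuN p (g * h)`_i * (n - j))%N) ->
  coprime (nuN p (g * h)`_0) j -> coprime (nuN p (g * h)`_n) (n - j) ->
  (size g).-1 \in [:: 0; j; n - j; n]%N.
Proof.
move=> pp /andP[j0 jn] sgh gh0 ghj nuj lt_j gt_j cop0 copn.
have gh_neq0 : g * h != 0 by rewrite -size_poly_eq0 sgh.
have [g0 h0] : g != 0 /\ h != 0.
  by apply/andP; rewrite -negb_or -mulf_eq0.
set r := (size g).-1; pose s := (size h).-1.
have rs : (r + s = n)%N.
  have : n.+1 = (size g + size h).-1 by rewrite -sgh size_mul.
  move: g0 h0; rewrite -!size_poly_gt0 /r /s; lia.
have gr : g`_r != 0 by rewrite -/(lead_coef g) lead_coef_eq0.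
have hs : h`_s != 0 by rewrite -/(lead_coef h) lead_coef_eq0.
have ghn : (g * h)`_n = g`_r * h`_s.
  by have := lead_coefM g h; rewrite /lead_coef sgh.
have gh0E : (g * h)`_0 = g`_0 * h`_0 by rewrite coefM big_ord1.
have [g00 h00] : g`_0 != 0 /\ h`_0 != 0.
  by apply/andP; rewrite -negb_or -mulf_eq0 -gh0E.
have [u [uj pu]] : exists u, (u <= j)%N /\ ~~ (p %| g`_u * h`_(j - u))%Z.
  have : ~~ (p %| (g * h)`_j)%Z by rewrite -(expn1 p) dvdz_pexp // nuj.
  rewrite coefM => ndvd.
  have [/forallP alld|] :=
    boolP [forall i : 'I_j.+1, (p %| g`_i * h`_(j - i))%Z].
    by case/negP: ndvd; apply: rpred_sum => i _; apply: alld.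
  by case/forallPn=> -[u /= uj]; exists u.
have guhw : g`_u * h`_(j - u) != 0.
  by apply: contraNneq pu => ->; rewrite dvdz0.
have [gu hw] : g`_u != 0 /\ h`_(j - u) != 0.
  by apply/andP; rewrite -negb_or -mulf_eq0.
have [nuu nuw] : nuN p g`_u = 0%N /\ nuN p h`_(j - u) = 0%N.
  move: pu; have := dvdz_pexp 1 pp guhw.
  rewrite expn1 nuNM // => ->; rewrite lt0n negbK addn_eq0.
  by case/andP => /eqP -> /eqP ->.
have ur : (u <= r)%N.
  by rewrite -ltnS prednK ?size_poly_gt0 ?coef_neq0_size.
have ws : (j - u <= s)%N.
  by rewrite -ltnS prednK ?size_poly_gt0 ?coef_neq0_size.
have dvdu : (j %| u)%N.
  (* This weight takes the same value at both ends 0 and [j] of the left edge; that value is the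
     bound. *)
  have ge0 l : (g * h)`_l != 0 ->
      (nuN p (g * h)`_0 * j)%:Z <=
      weight p j (nuN p (g * h)`_0)%:Z (g * h) l.
    move=> ghl; rewrite /weight -PoszM -PoszD lez_nat.
    have [->|l0] := posnP l; first by rewrite muln0 addn0 mulnC.
    have [lj|jl] := ltnP l j; last first.
      by rewrite (leq_trans _ (leq_addl _ _)) // leq_mul2l jl orbT.
    have := lt_j l; rewrite l0 lj => /(_ isT ghl).
    by rewrite mulnBr leq_subLR addnC (mulnC j).
  (* Pairing the constant coefficient of one factor with the coefficient prime to [p] of the other
     yields the two inequalities of [edge_eq]. *)
  have := weight_mul_ge pp j0 ge0 g00 hw.
  have := weight_mul_ge pp j0 ge0 gu h00.
  rewrite /weight nuu nuw gh0E nuNM // => le1 le2.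
  have e : ((nuN p g`_0 + nuN p h`_0) * u = nuN p g`_0 * j)%N.
    move: (nuN p g`_0) (nuN p h`_0) le1 le2 => x y; clear -uj => le1 le2.
    move: (j - u)%N (subnKC uj) le1 le2 => w uw le1 le2.
    by apply: (edge_eq uw); rewrite -uw in le1 le2 *; lia.
  rewrite -(Gauss_dvdr _ (n := nuN p (g * h)`_0)) 1?coprime_sym //.
  by rewrite gh0E nuNM // e dvdn_mull.
have dvdr : (n - j %| r - u)%N.
  have nj0 : (0 < n - j)%N by rewrite subn_gt0.
  (* On the right edge [B] is negative, and the common value at [j] and [n] is the bound. *)
  have gen l : (g * h)`_l != 0 ->
      - (nuN p (g * h)`_n * j)%:Z <=
      weight p (n - j) (- (nuN p (g * h)`_n)%:Z) (g * h) l.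
    move=> ghl; rewrite /weight mulNr -PoszM -[leRHS]opprB lerN2.
    rewrite lerBlDr -PoszD lez_nat.
    have [lj|jl] := leqP l j.
      by rewrite (leq_trans _ (leq_addr _ _)) // leq_mul2l lj orbT.
    have ln : (l < n.+1)%N by rewrite -sgh coef_neq0_size.
    move: ln; rewrite ltnS leq_eqVlt => /orP[/eqP->|ln].
      by rewrite (mulnC (n - j)%N) -mulnDr subnKC // ltnW.
    have := gt_j l; rewrite jl ln => /(_ isT ghl).
    by rewrite mulnBr leq_subLR (mulnC (n - j)%N).
  have := weight_mul_ge pp nj0 gen gr hw.
  have := weight_mul_ge pp nj0 gen gu hs.
  rewrite /weight nuu nuw ghn nuNM // => le1 le2.
  have e : ((nuN p g`_r + nuN p h`_s) * (r - u) = nuN p g`_r * (n - j))%N.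
    move: (nuN p g`_r) (nuN p h`_s) le1 le2 => x y.
    clear -rs ur ws uj => le1 le2.
    have rsE : (r - u + (s - (j - u)) = n - j)%N by lia.
    move: (r - u)%N (s - (j - u))%N rsE le1 le2 (subnKC ur) (subnKC ws).
    move: (n - j)%N (j - u)%N (subnKC uj) => m w <- d e de le1 le2 rE sE.
    by apply: (edge_eq de); rewrite -rE -sE -de in le1 le2 *; lia.
  rewrite -(Gauss_dvdr _ (n := nuN p (g * h)`_n)) 1?coprime_sym //.
  by rewrite ghn nuNM // e dvdn_mull.
have multiple_le a b : (b <= a)%N -> (a %| b)%N -> b = 0%N \/ b = a.
  case: (posnP b) => [->|b0 ba ab]; first by left.
  by right; apply/eqP; rewrite eqn_leq ba dvdn_leq.
have runj : (r - u <= n - j)%N by clear -rs ur ws uj; lia.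
(* The degree [r] is the sum of [u], which is 0 or [j], and [r - u], which is 0 or [n - j]. *)
move: (multiple_le _ _ uj dvdu) (multiple_le _ _ runj dvdr).
by move: ur uj jn; rewrite !inE; clear; lia.
Qed.

Theorem theorem1p24 (n : nat) (a : nat -> int) (f : {poly int})
    (hf : f = \poly_(i < n.+1) a i) (ha : a 0%N * a n != 0)
    (j1 j2 : nat) (hj1 : (1 <= j1 <= n.-1)%N) (hj2 : (1 <= j2 <= n.-1)%N)
    (hj12 : j1 != j2) (hjn : (j1 + j2)%N != n)
    (p q : nat) (hp : prime p) (hq : prime q) (hpq : p != q)
    (hpj1 : nu p (a j1) = 0%E) (hqj2 : nu q (a j2) = 0%E)
    (hprod : (nu p (a 0%N) * nu q (a 0%N) * nu p (a n) * nu q (a n) != 0)%E)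
    (hp_lt : forall i : nat, (0 < i < j1)%N ->
      (nu p (a i) / ((j1 - i)%N%:R)%:E > nu p (a 0%N) / (j1%:R)%:E)%E)
    (hp_gt : forall i : nat, (j1 < i < n)%N ->
      (nu p (a i) / ((i - j1)%N%:R)%:E > nu p (a n) / ((n - j1)%N%:R)%:E)%E)
    (hq_lt : forall i : nat, (0 < i < j2)%N ->
      (nu q (a i) / ((j2 - i)%N%:R)%:E > nu q (a 0%N) / (j2%:R)%:E)%E)
    (hq_gt : forall i : nat, (j2 < i < n)%N ->
      (nu q (a i) / ((i - j2)%N%:R)%:E > nu q (a n) / ((n - j2)%N%:R)%:E)%E)
    (hgcd_p0 : gcdn (nuN p (a 0%N)) j1 = 1%N)
    (hgcd_pn : gcdn (nuN p (a n)) (n - j1)%N = 1%N)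
    (hgcd_q0 : gcdn (nuN q (a 0%N)) j2 = 1%N)
    (hgcd_qn : gcdn (nuN q (a n)) (n - j2)%N = 1%N) :
  irreducible_poly (map_poly intr f : {poly rat}).
Proof.
move: ha; rewrite mulf_eq0 negb_or => /andP[a0 an].
have fE i : (i <= n)%N -> f`_i = a i by rewrite hf coef_poly ltnS => ->.
have sf : size f = n.+1 by rewrite hf size_poly_eq.
have size_factor (g h : {poly int}) (l j : nat) :
    f = g * h -> prime l -> (1 <= j <= n.-1)%N -> nu l (a j) = 0%E ->
    (forall i, (0 < i < j)%N ->
      (nu l (a i) / ((j - i)%N%:R)%:E > nu l (a 0%N) / (j%:R)%:E)%E) ->
    (forall i, (j < i < n)%N ->
      (nu l (a i) / ((i - j)%N%:R)%:E > nu l (a n) / ((n - j)%N%:R)%:E)%E) ->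
    gcdn (nuN l (a 0%N)) j = 1%N -> gcdn (nuN l (a n)) (n - j)%N = 1%N ->
    (size g).-1 \in [:: 0; j; n - j; n]%N.
  move=> fgh l_prime /andP[j0 jn] /nu_eq0[aj nuj] lt_j gt_j gcd0 gcdn.
  have {}jn : (j < n)%N by lia.
  apply: (@newton_factor_size l j n g h); rewrite -?fgh ?fE ?(ltnW jn) //.
  - by rewrite j0.
  - move=> i /andP[i0 ij]; rewrite fE; last by lia.
    by move=> ai; apply/ltnW/nu_div_lt; rewrite ?subn_gt0 ?lt_j ?i0.
  - move=> i /andP[ji iN]; rewrite fE; last by lia.
    by move=> ai; apply/ltnW/nu_div_lt; rewrite ?subn_gt0 ?gt_j ?ji.
  - exact/eqP.
  - exact/eqP.
have int_inj : injective (intr : int -> rat) by exact: intr_inj.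
have sfQ : size (map_poly intr f : {poly rat}) = n.+1.
  by rewrite size_map_inj_poly.
split=> [|g sg g_dvd]; first by rewrite sfQ; lia.
(* By Gauss's lemma a rational divisor is a scalar multiple of an integer factor of the same
   degree. *)
have [g' [c c0 gE] [h fgh]] := dvdpP_rat_int g_dvd.
have sgg' : size g = size g' by rewrite gE size_scale // size_map_inj_poly.
have := size_factor g' h p j1 fgh hp hj1 hpj1 hp_lt hp_gt hgcd_p0 hgcd_pn.
have := size_factor g' h q j2 fgh hq hj2 hqj2 hq_lt hq_gt hgcd_q0 hgcd_qn.
have g'0 : g' != 0 by apply: contra_eq_neq sf => g'0; rewrite fgh g'0 mul0r size_poly0.
(* As [j1] is neither [j2] nor [n - j2], the two lists of degrees share only 0 and [n], and 0 is
   excluded by [sg]. *)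
rewrite -dvdp_size_eqp // sfQ; move: sg; rewrite sgg' -size_poly_gt0 in g'0 *.
rewrite !inE; clear -g'0 hj1 hj2 hj12 hjn; lia.
Qed.
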